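(* Let $\gamma\in(0,1)$, $N=\lfloor1/\gamma\rfloor$, let $M:\mathcal H_N\to\mathcal H_N$ be an admissible renormalisation map, let $X$ be a branched $\gamma$-rough path with associated anisotropic rough path $\bar X$, and let $\overline{M^*X}$ be the anisotropic rough path associated with the branched $\gamma$-rough path $M^*X$. Let $g\in\mathcal C^\gamma$ be the unique element with $gX=M^*X$, i.e. $\langle X_{st},M\tau\rangle=\langle g\bar X_{st},\psi(\tau)\rangle$ for all non-empty $\tau\in\mathcal T_N$. Then, for every non-empty $\tau\in\mathcal T_N$ and all $s,t\in[0,1]$, $$g_t^\tau-g_s^\tau=\langle\overline{M^*X}_{st},\tau\rangle-\langle\bar X_{st},\tau\rangle ,$$ where in the pairings $\tau$ is regarded as a one-letter word.
   Context: **Trees and forests.** $\mathcal T$: (non-planar) rooted trees with nodes decorated by $\{0,\dots,d\}$; $|\tau|$ = number of nodes, $|\tau|_0$ = number of nodes decorated by $0$, $\gamma_\tau=(1-\gamma)|\tau|_0+\gamma|\tau|$; $\mathcal T_k$ = trees with at most $k$ nodes; $\mathbf 1$ = empty tree/forest. $\mathcal H$ = linear span of forests with the (commutative) forest product; $\mathcal H_N$ = span of forests with at most $N$ nodes. $B_+^i(f)$ connects the roots of the forest $f$ to a new root decorated by $i$. The coproduct $\Delta$ is the algebra morphism with $\Delta\mathbf 1=\mathbf 1\otimes\mathbf 1$, $\Delta B_+^i(f)=B_+^i(f)\otimes\mathbf 1+(\mathrm{id}\otimes B_+^i)\Delta f$. $\mathcal G_N$ = truncated characters of $\mathcal H_N$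 (linear $X:\mathcal H_N\to\mathbb R$ with $X(\mathbf 1)=1$, $X(fh)=X(f)X(h)$ when $fh\in\mathcal H_N$), with product $X\star Y=(X\otimes Y)\Delta$ and unit the counit $\mathbf 1^*$. **Branched rough paths.** A branched $\gamma$-rough path is a map $X:[0,1]^2\to\mathcal G_N$ with $X_{tt}=\mathbf 1^*$, $X_{su}\star X_{ut}=X_{st}$ and $|\langle X_{st},\tau\rangle|\lesssim|t-s|^{\gamma_\tau}$ for each tree $\tau\in\mathcal T_N$. **Words and the Hairer–Kelly map.** $T(\mathcal T)$ = span of words with letters non-empty trees, empty word $\varepsilon$, a Hopf algebra with the shuffle product $\sqcup\!\sqcup$ and deconcatenation $\bar\Delta$. $\psi:\mathcal H\to T(\mathcal T)$ is the unique Hopf algebra morphism with $\psi(\tau)=(\psi\otimes P_{\mathbf 1})\Delta\tau$ for non-empty trees $\tau$, where $P_{\mathbf 1}=\mathrm{id}-\mathbf 1^*$ and the last tensor factor is appended as last letter. For a non-empty tree, $\psi(\tau)=\tau+\psi_{|\tau|-1}(\tau)$ where $\psi_{|\tau|-1}(\tau)$ only involves words of total size $|\tau|$ with letters in $\mathcal T_{|\tau|-1}$. **Anisotropic rough paths.** $T_N(\mathcal T_k)$ = span of words with letters non-empty trees in $\mathcal T_k$ and total number of nodes at most $N$. An anisotropic rough path on $T_N(\mathcal T_k)$ is a map $Y$ from $[0,1]^2$ to linear functionals on $T_N(\mathcal T_k)$ with $\langle Y_{st},\varepsilon\rangle=1$, $\langle Y_{st},u\sqcup\!\sqcup v\rangle=\langle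 Y_{st},u\rangle\langle Y_{st},v\rangle$ whenever $u,v$ have total size at most $N$, $Y_{tt}=\varepsilon^*$, $Y_{st}=(Y_{su}\otimes Y_{ut})\bar\Delta$, and $|\langle Y_{st},\tau_1\cdots\tau_n\rangle|\lesssim|t-s|^{\gamma_{\tau_1}+\cdots+\gamma_{\tau_n}}$. It is over paths $(y^\tau)$ if $\langle Y_{st},\tau\rangle=y^\tau_t-y^\tau_s$ for all letters $\tau$. **Lyons–Victoir extension.** All choices in the Lyons–Victoir extension theorem are fixed: for each $0\le k<N$ there is a fixed map sending an anisotropic rough path on $T_N(\mathcal T_k)$ and paths $y^\tau\in C^{\gamma_\tau}([0,1])$, $y^\tau_0=0$, $|\tau|=k+1$, to an anisotropic rough path on $T_N(\mathcal T_{k+1})$ extending the given one and lying over the $y^\tau$ for the new letters. (Here $y\in C^{\alpha}$ means $|y_t-y_s|\lesssim|t-s|^\alpha$.) Iterating from $k=0$ assigns to each family $(y^\tau)_{\tau\in\mathcal T_N}$ an anisotropic rough path on $T_N(\mathcal T_N)$ over it. **The path $\bar X$.** Given a branched $\gamma$-rough path $X$, build inductively $\bar X^{(k)}$ on $T_N(\mathcal T_k)$: for $|\tau|=k+1$ let $x^\tau$ be the path with $x^\tau_0=0$, $x^\tau_t-x^\tau_s=\langle X_{st},\tau\rangle-\langle\bar X^{(k)}_{st},\psi_k(\tau)\rangle$ (which is well defined), and let $\bar X^{(k+1)}$ be the Lyons–Victoir extension of $\bar X^{(k)}$ by these paths. Then $\bar X:=\bar X^{(N)}$ satisfies $\langle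 X,\tau\rangle=\langle\bar X,\psi(\tau)\rangle$ for $\tau\in\mathcal T_N$. The notation $\overline{(\cdot)}$ is used for this construction applied to any branched $\gamma$-rough path. **The action.** $\mathcal C^\gamma=\{(g^\tau)_{\tau\in\mathcal T_N,\tau\ne\mathbf 1}:g^\tau_0=0,\ g^\tau\in C^{\gamma_\tau}([0,1])\}$. For $g\in\mathcal C^\gamma$, $g\bar X$ is the anisotropic rough path assigned by the (iterated) Lyons–Victoir extension to $(x^\tau+g^\tau)_\tau$, where $x^\tau_0=0$ and $x^\tau_t-x^\tau_s=\langle\bar X_{st},\tau\rangle$, and $gX$ is the branched $\gamma$-rough path $\langle gX_{st},\tau\rangle:=\langle g\bar X_{st},\psi(\tau)\rangle$. It is known (Tapia–Zambotti) that for any two branched $\gamma$-rough paths $X,X'$ there is a unique $g\in\mathcal C^\gamma$ with $gX=X'$. **Admissible renormalisation map.** A linear $M:\mathcal H_N\to\mathcal H_N$, multiplicative for the (truncated) forest product, with $M\mathbf 1=\mathbf 1$, $(M\otimes M)\Delta=\Delta M$, and for each non-empty tree $\tau$: $M\tau=\sum_i\lambda_i\tau_i$, a finite combination of trees with $\gamma_{\tau_i}\ge\gamma_\tau$, $|\tau_i|\le|\tau|$. $M^*X$ denotes $X\circ M$, again a branched $\gamma$-rough path. *)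

(* Defs.v *)
From HB Require Import structures.
From mathcomp Require Import all_boot all_order all_algebra finmap.
From mathcomp Require Import interval_inference monalg reals exp.

Set Implicit Arguments.
Unset Strict Implicit.
Unset Printing Implicit Defensive.

Import Order.TTheory GRing.Theory Num.Theory.
Local Open Scope ring_scope.

Local Notation "1" := (@mone _) : monom_scope.
Local Notation "x * y" := (mmul x y) : monom_scope.

(* [{malg R[K]}] is the free R-module on [K], [basis k] being the basis vector *)
(* of index [k] (locked, so that conversion does not unfold it).  The tensor   *)
(* product of the free modules on [A] and on [B] is the free module on         *)
(* [A * B], the basis vector [(a, b)] being [a (x) b].                         *)
HB.lock Definition basis {R : comNzRingType} {K : choiceType} (k : K) :
  {malg R[K]} := << k >>.
Canonical basis_unlockable := Unlockable basis.unlock.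

(* The linear map with prescribed values on the basis. *)
HB.lock Definition lin {R : comNzRingType} {K : choiceType} {V : lmodType R}
  (f : K -> V) (h : {malg R[K]}) : V := \sum_(k <- msupp h) h@_k *: f k.
Canonical lin_unlockable := Unlockable lin.unlock.

Section FreeModules.
Context {R : comNzRingType}.

Lemma mcoeff_basis {K : choiceType} (k l : K) :
  (basis k : {malg R[K]})@_l = (k == l)%:R.
Proof. by rewrite unlock mcoeffU. Qed.

Lemma msupp_basis {K : choiceType} (k : K) :
  msupp (basis k : {malg R[K]}) = [fset k]%fset.
Proof. by rewrite unlock msuppU oner_eq0. Qed.

Lemma basis1 {K : monomType} : basis (1%M : K) = 1 :> {malg R[K]}.
Proof. by rewrite unlock. Qed.

Section Lin.
Context {K : choiceType} {V : lmodType R}.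

Lemma linE (f : K -> V) (h : {malg R[K]}) :
  lin f h = \sum_(k <- msupp h) h@_k *: f k.
Proof. by rewrite unlock. Qed.

Lemma linEw (f : K -> V) (D : {fset K}) (h : {malg R[K]}) :
  (msupp h `<=` D)%fset -> lin f h = \sum_(k <- D) h@_k *: f k.
Proof.
move=> sub; rewrite linE (big_fset_incl _ sub) // => k _ /mcoeff_outdom ->.
by rewrite scale0r.
Qed.

Lemma lin_is_linear (f : K -> V) : linear (lin f).
Proof.
move=> c u v; pose D := (msupp u `|` msupp v)%fset.
have su : (msupp u `<=` D)%fset by rewrite fsubsetUl.
have sv : (msupp v `<=` D)%fset by rewrite fsubsetUr.
have suv : (msupp (c *: u + v) `<=` D)%fset.
  by rewrite (fsubset_trans (msuppD_le _ _)) // fsetSU // msuppZ_le.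
rewrite (linEw _ su) (linEw _ sv) (linEw _ suv) scaler_sumr -big_split /=.
by apply: eq_bigr => k _; rewrite mcoeffD mcoeffZ scalerDl scalerA.
Qed.

HB.instance Definition _ f :=
  GRing.isLinear.Build R {malg R[K]} V _ (lin f) (lin_is_linear f).

Lemma linU (f : K -> V) k : lin f (basis k) = f k.
Proof. by rewrite linE msupp_basis big_seq_fset1 mcoeff_basis eqxx scale1r. Qed.

Lemma eq_in_lin (f g : K -> V) h : {in msupp h, f =1 g} -> lin f h = lin g h.
Proof.
by move=> fg; rewrite !linE; apply: eq_big_seq => k kh; rewrite fg.
Qed.

End Lin.

Lemma msupp_lin {K L : choiceType} (f : K -> {malg R[L]}) h l :
  l \in msupp (lin f h) -> exists2 k, k \in msupp h & l \in msupp (f k).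
Proof.
move=> lh; apply/hasP; rewrite -[has _ _]negbK -all_predC; apply/negP => /allP nl.
move: lh; rewrite -mcoeff_neq0 linE raddf_sum /= big1_seq ?eqxx // => k /andP[_ kh].
by have /= nlk := nl k kh; rewrite mcoeffZ (mcoeff_outdom nlk) mulr0.
Qed.

Lemma lin_id {K : choiceType} (h : {malg R[K]}) : lin (fun k => basis k) h = h.
Proof.
rewrite [RHS]monalgE linE; apply: eq_bigr => k _; apply/malgP => l.
by rewrite mcoeffZ mcoeff_basis mcoeffU mulrnAr mulr1.
Qed.

Lemma eq_linear {K : choiceType} {V : lmodType R}
    (f g : {linear {malg R[K]} -> V}) :
  (forall k, f (basis k) = g (basis k)) -> f =1 g.
Proof.
move=> fg h; rewrite -(lin_id h) linE !linear_sum.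
by apply: eq_bigr => k _; rewrite !linearZ /= fg.
Qed.

Definition otimes {A B : choiceType} (u : {malg R[A]}) (v : {malg R[B]}) :
  {malg R[(A * B)%type]} := lin (fun a => lin (fun b => basis (a, b)) v) u.

Lemma otimesU {A B : choiceType} (a : A) (b : B) :
  otimes (basis a) (basis b) = basis (a, b).
Proof. by rewrite /otimes !linU. Qed.

Lemma otimesu0 {A B : choiceType} (u : {malg R[A]}) :
  otimes u (0 : {malg R[B]}) = 0.
Proof. by rewrite /otimes linE big1 // => k _; rewrite linear0 scaler0. Qed.

(* f (x) g, for linear f and g. *)
Definition tens {A B C D : choiceType} (f : {malg R[A]} -> {malg R[C]})
    (g : {malg R[B]} -> {malg R[D]}) :
  {malg R[(A * B)%type]} -> {malg R[(C * D)%type]} :=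
  lin (fun p => otimes (f (basis p.1)) (g (basis p.2))).

(* The span of the basis vectors satisfying [P]. *)
Definition fspan {K : choiceType} (P : pred K) := {malg R[{x : K | P x}]}.

Definition incl {K : choiceType} {P : pred K} : fspan P -> {malg R[K]} :=
  lin (fun x => basis (val x)).

(* The projection which kills the basis vectors that do not satisfy [P]; it is *)
(* only used to see elements of the span of [P] as such.                       *)
Definition trunc {K : choiceType} {P : pred K} : {malg R[K]} -> fspan P :=
  lin (fun x => oapp (fun y : {x : K | P x} => basis y) 0 (insub x)).

Lemma incl_truncU {K : choiceType} (P : pred K) k :
  P k -> incl (trunc (basis k) : fspan P) = basis k.
Proof. by move=> Pk; rewrite /trunc linU insubT /incl linU. Qed.

Definition functional {K : choiceType} (P : pred K) := {linear fspan P -> R^o}.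

Definition pairing {K : choiceType} {P : pred K} (X : functional P)
  (h : {malg R[K]}) : R := X (trunc h).

Definition ftens {A B : choiceType} {P : pred A} {Q : pred B}
    (X : functional P) (Y : functional Q) : {malg R[(A * B)%type]} -> R :=
  lin (fun p => pairing X (basis p.1) * pairing Y (basis p.2) : R^o).

End FreeModules.

Arguments fspan : clear implicits.
Arguments fspan R {K} P.
Arguments functional : clear implicits.
Arguments functional R {K} P.

Notation "⟨ X , h ⟩" := (pairing X h)
  (at level 0, X at level 200, h at level 200, format "⟨ X ,  h ⟩") : ring_scope.

(* Componentwise product: it makes [{malg R[A * B]}] the tensor product algebra. *)
Section ProductMonomials.
Variables A B : conomType.

Definition pair_mone : A * B := (1%M, 1%M).
Definition pair_mmul (x y : A * B) : A * B := ((x.1 * y.1)%M, (x.2 * y.2)%M).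

Lemma pair_mmulA : associative pair_mmul.
Proof. by move=> x y z; rewrite /pair_mmul /= !mulmA. Qed.

Lemma pair_mmul1m : left_id pair_mone pair_mmul.
Proof. by case=> x y; rewrite /pair_mmul /= !mul1m. Qed.

Lemma pair_mmulm1 : right_id pair_mone pair_mmul.
Proof. by case=> x y; rewrite /pair_mmul /= !mulm1. Qed.

Lemma pair_unitm x y :
  pair_mmul x y = pair_mone -> x = pair_mone /\ y = pair_mone.
Proof. by case: x y => [x1 x2] [y1 y2] [] /unitm[-> ->] /unitm[-> ->]. Qed.

Lemma pair_mmulC : commutative pair_mmul.
Proof. by move=> x y; rewrite /pair_mmul mulmC [(x.2 * _)%M]mulmC. Qed.

HB.instance Definition _ := Choice_isMonomialDef.Build (A * B)%type
  pair_mmulA pair_mmul1m pair_mmulm1 pair_unitm.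
HB.instance Definition _ :=
  MonomialDef_isConomialDef.Build (A * B)%type pair_mmulC.

End ProductMonomials.

Section Trees.
Context {d : nat}.

(* Planar trees, from which the (non-planar) trees are obtained below. *)
Inductive ptree := PNode of 'I_d.+1 & seq ptree.

Lemma ptree_ind' (P : ptree -> Prop) :
    (forall i s, foldr (fun t => and (P t)) True s -> P (PNode i s)) ->
  forall t, P t.
Proof.
move=> PN; fix ih 1 => -[i s]; apply: PN.
by elim: s => [|c s ihs] /=; [|split; [exact: ih | exact: ihs]].
Qed.

Fixpoint ptree_encode (t : ptree) : GenTree.tree 'I_d.+1 :=
  let: PNode i s := t in GenTree.Node 0 (GenTree.Leaf i :: map ptree_encode s).

Fixpoint ptree_decode (t : GenTree.tree 'I_d.+1) : option ptree :=
  if t is GenTree.Node _ (GenTree.Leaf i :: s)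
  then Some (PNode i (pmap ptree_decode s)) else None.

Lemma ptree_encodeK : pcancel ptree_encode ptree_decode.
Proof.
elim/ptree_ind' => i s ih /=; congr (Some (PNode i _)).
by elim: s ih => [|c s ihs] //= [-> /ihs] /= ->.
Qed.

HB.instance Definition _ := Countable.copy ptree (pcan_type ptree_encodeK).

(* An arbitrary total order on planar trees. *)
Definition ptree_le : rel ptree := fun t u => (choice.pickle t <= choice.pickle u)%N.

Lemma ptree_le_total : total ptree_le.
Proof. by move=> t u; apply: leq_total. Qed.

Lemma ptree_le_trans : transitive ptree_le.
Proof. by move=> t u v; apply: leq_trans. Qed.

Lemma ptree_le_anti : antisymmetric ptree_le.
Proof.
by move=> t u; rewrite /ptree_le -eqn_leq => /eqP/(pcan_inj choice.pickleK).
Qed.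

(* Sort the branches at every node: two planar trees have the same canonical   *)
(* form if and only if they are the same up to the order of branches.          *)
Fixpoint canon (t : ptree) : ptree :=
  let: PNode i s := t in PNode i (sort ptree_le (map canon s)).

Lemma canon_id t : canon (canon t) == canon t.
Proof.
apply/eqP; elim/ptree_ind': t => i s ih /=; congr PNode.
have -> : map canon (sort ptree_le (map canon s)) = sort ptree_le (map canon s).
  have: forall t, t \in sort ptree_le (map canon s) -> canon t = t.
    move=> t; rewrite mem_sort => /mapP[u + ->].
    by elim: s ih => [|c s ihs] //= [cc /ihs us]; rewrite inE => /predU1P[-> | /us].
  by move/eq_in_map ->; rewrite map_id.
by rewrite sorted_sort ?sort_sorted //;
  [exact: ptree_le_trans | exact: ptree_le_total].
Qed.

(* Non-planar, non-empty trees, represented by their canonical planar form. *)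
Record tree := Tree { tree_val :> ptree; _ : canon tree_val == tree_val }.
HB.instance Definition _ := [isSub for tree_val].
HB.instance Definition _ := [Countable of tree by <:].

Definition to_tree (t : ptree) : tree := Tree (canon_id t).

Lemma to_treeK (t : tree) : to_tree t = t.
Proof. by apply: val_inj => /=; apply/eqP/(valP t). Qed.

Fixpoint pnodes (P : pred 'I_d.+1) (t : ptree) : nat :=
  let: PNode i s := t in (P i + sumn (map (pnodes P) s))%N.

Definition nodes (t : tree) : nat := pnodes predT t.

Definition nodes0 (t : tree) : nat := pnodes (pred1 ord0) t.

(* Forests: finite multisets of non-empty trees, the neutral element being the *)
(* empty forest and [ucm t] the forest with the single tree [t].               *)
Definition forest := {cmonom tree}.

Definition trees (f : forest) : seq tree :=
  flatten [seq nseq (f t) t | t <- finsupp f].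

Definition fnodes (f : forest) : nat := sumn (map nodes (trees f)).

Definition Bplus (i : 'I_d.+1) (f : forest) : tree :=
  to_tree (PNode i [seq val t | t <- trees f]).

Lemma count_trees (f : forest) t : count_mem t (trees f) = f t.
Proof.
rewrite count_flatten -map_comp.
have -> : f t = (\sum_(u <- finsupp f) (t == u) * f t)%N.
  case: (boolP (t \in finsupp f)) => tf.
    rewrite (big_fsetD1 t) //= eqxx mul1n big1_fset ?addn0 // => u.
    by rewrite in_fsetD1 eq_sym => /andP[/negPf ->].
  by rewrite (fsfun_dflt tf); rewrite big1 // => *; rewrite muln0.
rewrite sumnE big_map; apply: eq_bigr => u _ /=.
rewrite count_nseq /= eq_sym; case: eqVneq => [->|_] //.
Qed.

Lemma trees1 : trees 1%M = [::].
Proof. by rewrite /trees mdom1. Qed.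

Lemma treesU t : trees (ucm t) = [:: t].
Proof.
apply: perm_small_eq => //; apply/allP => u _ /=.
by rewrite count_trees cmU addn0.
Qed.

Lemma perm_treesM f h : perm_eq (trees (f * h)%M) (trees f ++ trees h).
Proof. by apply/allP => t _ /=; rewrite count_cat !count_trees cmM. Qed.

Lemma fnodes1 : fnodes 1%M = 0%N.
Proof. by rewrite /fnodes trees1. Qed.

Lemma fnodesU t : fnodes (ucm t) = nodes t.
Proof. by rewrite /fnodes treesU /= addn0. Qed.

Lemma fnodesM f h : fnodes (f * h)%M = (fnodes f + fnodes h)%N.
Proof.
by rewrite /fnodes (perm_sumn (perm_map _ (perm_treesM f h))) map_cat sumn_cat.
Qed.

Lemma pnodes_canon P t : pnodes P (canon t) = pnodes P t.
Proof.
elim/ptree_ind': t => i s ih /=; congr addn.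
have /permPl/(perm_map (pnodes P))/perm_sumn -> := perm_sort ptree_le (map canon s).
by rewrite -map_comp; congr sumn; elim: s ih => [|c s ihs] //= [-> /ihs ->].
Qed.

Lemma nodes_Bplus i f : nodes (Bplus i f) = (fnodes f).+1.
Proof. by rewrite /nodes pnodes_canon /= -map_comp. Qed.

Lemma nodes_gt0 t : (0 < nodes t)%N.
Proof. by case: t => -[]. Qed.

Lemma nodes_le_fnodes t f : t \in trees f -> (nodes t <= fnodes f)%N.
Proof.
rewrite /fnodes; elim: (trees f) => [//|u s ih]; rewrite inE /= => /predU1P[->|/ih].
  exact: leq_addr.
by move=> ts; rewrite (leq_trans ts) // leq_addl.
Qed.

Lemma fnodes_eq0 f : fnodes f = 0%N -> f = 1%M.
Proof.
move=> f0; apply/eqP/cmP => t; rewrite cm1 -count_trees; apply/count_memPn.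
by apply/negP => /nodes_le_fnodes; rewrite f0 leqNgt nodes_gt0.
Qed.

Definition word := seq tree.

Definition wnodes (w : word) : nat := sumn (map nodes w).

Fixpoint shuffles (u : word) : word -> seq word :=
  if u is a :: u' then
    fix shuffles_u (v : word) : seq word :=
      if v is b :: v' then
        map (cons a) (shuffles u' v) ++ map (cons b) (shuffles_u v')
      else [:: u]
  else fun v => [:: v].

End Trees.

Arguments ptree : clear implicits.
Arguments tree : clear implicits.
Arguments forest : clear implicits.
Arguments word : clear implicits.

Section HopfAlgebras.
Context {R : comNzRingType} {d : nat}.

(* The algebra of forests, its tensor square, and the space of words in trees. *)
Notation H := {malg R[forest d]}.
Notation HH := {malg R[(forest d * forest d)%type]}.
Notation T := {malg R[word d]}.

Definition BplusH (i : 'I_d.+1) : H -> H :=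
  lin (fun f => basis (ucm (Bplus i f))).

(* The image of the tree [t] = B_+^i(f) under the coproduct, by recursion on   *)
(* the branches f; see [coprod_Bplus] for the resulting identity on trees.     *)
Fixpoint coprod_ptree (t : ptree d) : HH :=
  let: PNode i s := t in
  basis (ucm (to_tree t), 1%M)
  + tens id (BplusH i) (foldr (fun c z => coprod_ptree c * z) 1 s).

Definition coprod_forest (f : forest d) : HH :=
  \prod_(t <- trees f) coprod_ptree t.

Definition coprod : H -> HH := lin coprod_forest.

Definition shuffle (x y : T) : T :=
  lin (fun u => lin (fun v => \sum_(w <- shuffles u v) basis w) y) x.

Definition deconc : T -> {malg R[(word d * word d)%type]} :=
  lin (fun w => \sum_(i < (size w).+1) basis (take i w, drop i w)).

Lemma shuffleU u v :
  shuffle (basis u) (basis v) = \sum_(w <- shuffles u v) basis w.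
Proof. exact: etrans (linU _ u) (linU _ v). Qed.

Lemma deconcU w :
  deconc (basis w) = \sum_(i < (size w).+1) basis (take i w, drop i w).
Proof. exact: linU. Qed.

(* id - 1^*, the counit 1^* being the coefficient of the empty forest. *)
Definition P1 (h : H) : H := h - h@_1 *: basis 1%M.

(* w (x) t |-> wt, for trees t. *)
Definition append : {malg R[(word d * forest d)%type]} -> T :=
  lin (fun p => if trees p.2 is [:: t] then basis (rcons p.1 t) else 0).

(* The Hairer-Kelly map psi is the algebra morphism from [H] with the forest   *)
(* product to [T] with the shuffle product such that psi(t) = (psi (x) P1) D t *)
(* on trees, D being the coproduct.  This is a recursion on the number of      *)
(* nodes; the extra argument bounds its depth.                                 *)
Fixpoint psi_rec (n : nat) (t : tree d) : T :=
  if n is n'.+1 then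
    append (tens
      (lin (fun f => foldr shuffle (basis [::]) (map (psi_rec n') (trees f))))
      P1 (coprod (basis (ucm t))))
  else 0.

Lemma coprodU f : coprod (basis f) = coprod_forest f.
Proof. exact: linU. Qed.

Lemma coprod1 : coprod (basis 1%M) = basis (1%M, 1%M).
Proof. by rewrite coprodU /coprod_forest trees1 big_nil -basis1. Qed.

Lemma coprodM f h : coprod (basis (f * h)%M) = coprod (basis f) * coprod (basis h).
Proof.
by rewrite !coprodU /coprod_forest (perm_big _ (perm_treesM f h)) big_cat.
Qed.

Lemma coprod_Bplus i f : coprod (basis (ucm (Bplus i f))) =
  basis (ucm (Bplus i f), 1%M) + tens id (BplusH i) (coprod (basis f)).
Proof.
have E1 : to_tree (Bplus i f) = Bplus i f := to_treeK _.
have E2 : foldr (fun c z => coprod_ptree c * z) 1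
    (sort ptree_le (map canon (map val (trees f)))) = coprod_forest f.
  have -> : map canon (map val (trees f)) = map val (trees f).
    by rewrite -map_comp; apply: eq_map => t /=; apply/eqP/(valP t).
  transitivity (\prod_(t <- sort ptree_le (map val (trees f))) coprod_ptree t).
    by rewrite unlock.
  by rewrite (perm_big _ (permEl (perm_sort ptree_le _))) big_map.
rewrite coprodU /coprod_forest treesU big_seq1.
by rewrite -[tree_val _]/(PNode i _) [coprod_ptree _]/= E2 -coprodU -[in RHS]E1.
Qed.

Lemma coprod_nodes f p :
  p \in msupp (coprod (basis f)) -> (fnodes p.1 + fnodes p.2)%N = fnodes f.
Proof.
have mulP (x y : HH) m n :
    {in msupp x, forall p, fnodes p.1 + fnodes p.2 = m}%N ->
    {in msupp y, forall p, fnodes p.1 + fnodes p.2 = n}%N ->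
    {in msupp (x * y), forall p, fnodes p.1 + fnodes p.2 = m + n}%N.
  move=> xm yn q /msuppM_le[a [b [/xm <- /yn <- ->]]] /=.
  by rewrite !fnodesM addnACA.
have oneP : {in msupp (1 : HH), forall p, fnodes p.1 + fnodes p.2 = 0}%N.
  by move=> q; rewrite -basis1 msupp_basis in_fset1 => /eqP -> /=; rewrite fnodes1.
have treeP t : {in msupp (coprod_ptree t),
    forall p, fnodes p.1 + fnodes p.2 = pnodes predT t}%N.
  move: t; apply: ptree_ind' => i s ih q /=.
  move=> /(fsubsetP (msuppD_le _ _)); rewrite in_fsetU => /orP[|].
    rewrite msupp_basis in_fset1 => /eqP -> /=.
    by rewrite fnodesU fnodes1 addn0 /nodes pnodes_canon.
  case/msupp_lin => r + /=; rewrite /BplusH linU otimesU msupp_basis in_fset1.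
  move=> rs /eqP -> /=; rewrite fnodesU nodes_Bplus addnS add1n; congr _.+1.
  elim: s ih r rs => [|c s ihs] /= [] => [|ihc /ihs {}ihs]; last exact: mulP.
  exact: oneP.
rewrite /coprod linU /coprod_forest /fnodes.
elim: (trees f) p => [|t s ihs] p; first by rewrite big_nil; apply: oneP.
rewrite big_cons; apply: mulP => //; exact: treeP.
Qed.

Definition psi_tree (t : tree d) : T := psi_rec (nodes t) t.

Definition psi_forest (f : forest d) : T :=
  foldr shuffle (basis [::]) (map psi_tree (trees f)).

Definition psi : H -> T := lin psi_forest.

Lemma psiU f : psi (basis f) = psi_forest f.
Proof. exact: linU. Qed.

Lemma P1_unit : P1 (basis 1%M) = 0.
Proof. by rewrite /P1 mcoeff_basis eqxx scale1r subrr. Qed.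

Let append_eq (F G : forest d -> T) t :
    (forall f, (fnodes f < nodes t)%N -> F f = G f) ->
  append (tens (lin F) P1 (coprod (basis (ucm t)))) =
  append (tens (lin G) P1 (coprod (basis (ucm t)))).
Proof.
move=> FG; apply: (congr1 append); apply: eq_in_lin => -[f h] /coprod_nodes.
rewrite fnodesU /= => fh; rewrite !linU.
have [->|h1] := eqVneq h 1%M; first by rewrite P1_unit !otimesu0.
rewrite FG // -fh -addn1 leq_add2l lt0n.
by apply: contra_neq h1 => /fnodes_eq0.
Qed.

Lemma psi_recE m n t : (nodes t <= m)%N -> (nodes t <= n)%N ->
  psi_rec m t = psi_rec n t.
Proof.
elim: m n t => [|m ihm] [|n] t; rewrite ?leqn0 => tm tn.
- by have := nodes_gt0 t; rewrite (eqP tm).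
- by have := nodes_gt0 t; rewrite (eqP tm).
- by have := nodes_gt0 t; rewrite (eqP tn).
apply: append_eq => f ft.
have sub u : u \in trees f -> psi_rec m u = psi_rec n u.
  move=> /nodes_le_fnodes uf; have ut := leq_ltn_trans uf ft.
  by apply: ihm; rewrite -ltnS (leq_trans ut).
by move/eq_in_map: sub => ->.
Qed.

(* The recursive description of psi on trees. *)
Lemma psi_treeE t :
  psi (basis (ucm t)) = append (tens psi P1 (coprod (basis (ucm t)))).
Proof.
have shufflee x : shuffle x (basis [::]) = x.
  rewrite -[RHS]lin_id.
  by apply: eq_in_lin => -[|a u] _; rewrite linU /= big_seq1.
rewrite psiU /psi_forest treesU [foldr _ _ _]/= shufflee.
apply: etrans (psi_recE (leqnn _) (leqnSn _)) _.
apply: append_eq => f ft; apply: (congr1 (foldr _ _)); apply/eq_in_map.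
move=> u /nodes_le_fnodes uf; apply: psi_recE (leqnn _).
exact: leq_trans uf (ltnW ft).
Qed.

End HopfAlgebras.

Section RoughPaths.
Context {R : realType} {d : nat}.
Variables (gamma : R) (N : nat).

Notation I := {i01 R}.
Notation H := {malg R[forest d]}.
Notation T := {malg R[word d]}.

Definition weight (t : tree d) : R :=
  (1 - gamma) * (nodes0 t)%:R + gamma * (nodes t)%:R.

Definition in_HN : pred (forest d) := fun f => (fnodes f <= N)%N.
Notation HN := (fspan R in_HN).

Definition truncated_character (X : functional R in_HN) : Prop :=
  ⟨X, basis 1%M⟩ = 1 /\
  forall f h : forest d, in_HN (f * h)%M ->
    ⟨X, basis (f * h)%M⟩ = ⟨X, basis f⟩ * ⟨X, basis h⟩.

Definition branched_rough_path (X : I -> I -> functional R in_HN) : Prop :=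
  [/\ forall s t, truncated_character (X s t),
      forall t (h : HN), X t t h = (incl h)@_1,
      forall s u t (h : HN), X s t h = ftens (X s u) (X u t) (coprod (incl h)) &
      forall tau : tree d, (nodes tau <= N)%N -> exists C : R, forall s t : I,
        `|⟨X s t, basis (ucm tau)⟩| <= C * `|t%:num - s%:num| `^ weight tau].

Definition in_TN (k : nat) : pred (word d) :=
  fun w => all (fun t => nodes t <= k)%N w && (wnodes w <= N)%N.
Notation TN k := (fspan R (in_TN k)).

Definition anisotropic (k : nat) (Y : I -> I -> functional R (in_TN k)) : Prop :=
  [/\ forall s t, ⟨Y s t, basis [::]⟩ = 1,
      forall s t (u v : word d), in_TN k u -> in_TN k v ->
        (wnodes u + wnodes v <= N)%N ->
        ⟨Y s t, shuffle (basis u) (basis v)⟩ = ⟨Y s t, basis u⟩ * ⟨Y s t, basis v⟩,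
      forall t (h : TN k), Y t t h = (incl h)@_[::],
      forall s u t (h : TN k), Y s t h = ftens (Y s u) (Y u t) (deconc (incl h)) &
      forall w : word d, in_TN k w -> exists C : R, forall s t : I,
        `|⟨Y s t, basis w⟩|
          <= C * `|t%:num - s%:num| `^ (\sum_(tau <- w) weight tau)].

Definition anisotropic_rough_path (k : nat) :=
  {Y : I -> I -> functional R (in_TN k) | anisotropic Y}.

Definition arp_fun k (Y : anisotropic_rough_path k) := proj1_sig Y.
Coercion arp_fun : anisotropic_rough_path >-> Funclass.

Definition Hoelder (alpha : R) (y : I -> R) : Prop :=
  exists C : R, forall s t : I, `|y t - y s| <= C * `|t%:num - s%:num| `^ alpha.

(* Families of paths starting from 0, one in C^(weight tau) for every tree tau *)
(* satisfying [P].                                                             *)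
Definition path_family (P : pred (tree d)) :=
  {y : {tau : tree d | P tau} -> I -> R |
    forall tau, y tau 0%:i01 = 0 /\ Hoelder (weight (val tau)) (y tau)}.

Definition path_fun P (y : path_family P) := proj1_sig y.
Coercion path_fun : path_family >-> Funclass.

Definition in_trees : pred (tree d) := fun tau => (nodes tau <= N)%N.

Notation Cgamma := (path_family in_trees).

Definition of_size (n : nat) : pred (tree d) := fun tau => nodes tau == n.

Lemma of_size_in n tau : (n <= N)%N -> of_size n tau -> in_trees tau.
Proof. by rewrite /of_size /in_trees => nN /eqP ->. Qed.

Definition widen_size n (nN : (n <= N)%N) (tau : {tau | of_size n tau}) :
  {tau | in_trees tau} := exist _ (val tau) (of_size_in nN (valP tau)).

Lemma restrict_subproof n (nN : (n <= N)%N) (y : Cgamma) tau :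
  y (widen_size nN tau) 0%:i01 = 0 /\
  Hoelder (weight (val tau)) (y (widen_size nN tau)).
Proof. exact: (proj2_sig y (widen_size nN tau)). Qed.

Definition restrict n (nN : (n <= N)%N) (y : Cgamma) : path_family (of_size n) :=
  exist _ (fun tau => y (widen_size nN tau)) (restrict_subproof nN y).

Lemma path_family_add P (x y : path_family P) (tau : {tau | P tau}) :
  x tau 0%:i01 + y tau 0%:i01 = 0 /\
  Hoelder (weight (val tau)) (fun t => x tau t + y tau t).
Proof.
have [x0 [Cx xC]] := proj2_sig x tau; have [y0 [Cy yC]] := proj2_sig y tau.
split; first by rewrite /path_fun x0 y0 addr0.
exists (Cx + Cy) => s t; rewrite opprD addrACA mulrDl.
exact: le_trans (ler_normD _ _) (lerD (xC s t) (yC s t)).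
Qed.

Definition add_paths P (x y : path_family P) : path_family P :=
  exist _ (fun tau t => x tau t + y tau t) (path_family_add x y).

(* A choice of Lyons-Victoir extensions. *)
Record lyons_victoir := LyonsVictoir {
  lv_fun :> forall k, (k < N)%N -> anisotropic_rough_path k ->
    path_family (of_size k.+1) -> anisotropic_rough_path k.+1;
  lv_extends : forall k (kN : (k < N)%N) Y y s t w, in_TN k w ->
    ⟨lv_fun kN Y y s t, basis w⟩ = ⟨Y s t, basis w⟩;
  lv_over : forall k (kN : (k < N)%N) Y y s t (tau : {tau | of_size k.+1 tau}),
    ⟨lv_fun kN Y y s t, basis [:: val tau]⟩ = y tau t - y tau s
}.

(* T_N(T_0) is spanned by the empty word. *)
Definition trivial_functional : functional R (in_TN 0) :=
  lin (fun=> 1 : R^o).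

Lemma in_TN0 w : in_TN 0 w = (w == [::]).
Proof. by case: w => [|t w] //=; rewrite /in_TN /= leqNgt nodes_gt0. Qed.

Lemma pairing_word k (Y : functional R (in_TN k)) (f : word d -> R^o) :
  (forall w (wk : in_TN k w), Y (basis (exist _ w wk : {w | in_TN k w})) = f w) ->
  forall w, in_TN k w -> pairing Y (basis w) = f w.
Proof. by move=> Yf w wk; rewrite /pairing /trunc linU insubT /= Yf. Qed.

Lemma trivial_anisotropic : anisotropic (fun _ _ : I => trivial_functional).
Proof.
have nil0 : in_TN 0 ([::] : word d) by rewrite in_TN0.
have triv w : in_TN 0 w -> pairing trivial_functional (basis w) = 1.
  by apply: (pairing_word (f := fun=> 1)) => u uk; rewrite /= linU.
have nilP (x : {w : word d | in_TN 0 w}) : val x = [::].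
  by apply/eqP; rewrite -in_TN0 (valP x).
split.
- by move=> _ _; apply: triv.
- move=> _ _ u v; rewrite !in_TN0 => /eqP -> /eqP -> _.
  by rewrite shuffleU big_seq1 triv // mulr1.
- move=> _ h; rewrite /incl [in RHS]linE raddf_sum [LHS]linE; apply: eq_bigr => x _.
  by rewrite /= mcoeffZ mcoeff_basis nilP eqxx.
- move=> _ _ _; rewrite /ftens /deconc /incl.
  apply: (eq_linear (f := trivial_functional) (g := lin _ \o (lin _ \o lin _))).
  move=> x; rewrite /= !linU nilP big_ord1 linU /=.
  by have := triv _ nil0; rewrite /pairing /= => ->; rewrite mulr1.
- move=> w; rewrite in_TN0 => /eqP ->; exists 1 => s t.
  by rewrite triv // normr1 big_nil powRr0 mulr1.
Qed.

Definition trivial_arp : anisotropic_rough_path 0 :=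
  exist _ _ trivial_anisotropic.

(* The iterated extension, up to level [k]. *)
Fixpoint lift_upto (LV : lyons_victoir) (y : Cgamma) (k : nat) :
    (k <= N)%N -> anisotropic_rough_path k :=
  if k is k'.+1 then
    fun kN => LV k' kN (lift_upto LV y (ltnW kN)) (restrict kN y)
  else fun=> trivial_arp.

Definition lift (LV : lyons_victoir) (y : Cgamma) : anisotropic_rough_path N :=
  lift_upto LV y (leqnn N).

Lemma arp_letter (Y : anisotropic_rough_path N) (tau : {tau | in_trees tau}) s t :
  ⟨Y 0%:i01 t, basis [:: val tau]⟩ - ⟨Y 0%:i01 s, basis [:: val tau]⟩ =
  ⟨Y s t, basis [:: val tau]⟩.
Proof.
have [Y1 _ _ chen _] := proj2_sig Y.
have tauN : in_TN N [:: val tau].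
  by rewrite /in_TN /= /wnodes /= addn0 !andbT andbb; apply: (valP tau).
have -> : ⟨Y 0%:i01 t, basis [:: val tau]⟩ =
    ⟨Y 0%:i01 s, basis [:: val tau]⟩ + ⟨Y s t, basis [:: val tau]⟩.
  rewrite [LHS](chen 0%:i01 s t) incl_truncU // deconcU.
  rewrite 2!big_ord_recl big_ord0 addr0 /ftens linearD /= !linU.
  by rewrite !Y1 mul1r mulr1 addrC.
by rewrite addrAC subrr add0r.
Qed.

Lemma letter_paths_subproof (Y : anisotropic_rough_path N)
    (tau : {tau | in_trees tau}) :
  ⟨Y 0%:i01 0%:i01, basis [:: val tau]⟩ = 0 /\
  Hoelder (weight (val tau)) (fun t => ⟨Y 0%:i01 t, basis [:: val tau]⟩).
Proof.
split; first by rewrite -(arp_letter Y tau 0%:i01 0%:i01) subrr.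
have [_ _ _ _ bound] := proj2_sig Y.
have tauN : in_TN N [:: val tau].
  by rewrite /in_TN /= /wnodes /= addn0 !andbT andbb; apply: (valP tau).
have [C YC] := bound _ tauN; exists C => s t.
by rewrite arp_letter; have := YC s t; rewrite big_seq1.
Qed.

(* The paths x^tau with x^tau_0 = 0 and increments <Y_st, tau>; see [arp_letter]. *)
Definition letter_paths (Y : anisotropic_rough_path N) : Cgamma :=
  exist _ (fun tau t => ⟨Y 0%:i01 t, basis [:: val tau]⟩)
    (letter_paths_subproof Y).

(* The action of g on an anisotropic rough path Y, written gY. *)
Definition act (LV : lyons_victoir) (g : Cgamma) (Y : anisotropic_rough_path N) :
  anisotropic_rough_path N := lift LV (add_paths (letter_paths Y) g).

(* psi_k(tau), for a tree tau with k+1 nodes. *)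
Definition psi_low (tau : tree d) : T := psi (basis (ucm tau)) - basis [:: tau].

(* [Xbar] is the anisotropic rough path built from [X]: the k-th stage of the  *)
(* construction, [lift_upto LV x k], only depends on the paths x^tau with      *)
(* |tau| <= k, and the increments of those with |tau| = k + 1 are prescribed   *)
(* by [X] and by that stage.                                                   *)
Definition associated (LV : lyons_victoir) (X : I -> I -> functional R in_HN)
    (Xbar : anisotropic_rough_path N) : Prop :=
  exists2 x : Cgamma, Xbar = lift LV x &
    forall k (kN : (k < N)%N) (tau : {tau | of_size k.+1 tau}) s t,
      x (widen_size kN tau) t - x (widen_size kN tau) s =
      ⟨X s t, basis (ucm (val tau))⟩
        - ⟨lift_upto LV x (ltnW kN) s t, psi_low (val tau)⟩.

Definition admissible (M : {linear HN -> HN}) : Prop :=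
  [/\ M (trunc (basis 1%M)) = trunc (basis 1%M),
      forall f h : forest d, in_HN (f * h)%M ->
        incl (M (trunc (basis (f * h)%M))) =
        incl (M (trunc (basis f))) * incl (M (trunc (basis h))),
      forall h : HN,
        tens (incl \o M \o trunc) (incl \o M \o trunc) (coprod (incl h)) =
        coprod (incl (M h)) &
      forall tau : tree d, in_trees tau -> exists2 s : seq (R * tree d),
        all (fun p => (weight tau <= weight p.2) && (nodes p.2 <= nodes tau)%N) s &
        incl (M (trunc (basis (ucm tau)))) = \sum_(p <- s) p.1 *: basis (ucm p.2)].

(* M^*X *)
Definition dual_action (M : {linear HN -> HN}) (X : I -> I -> functional R in_HN) :
  I -> I -> functional R in_HN := fun s t => X s t \o M.

End RoughPaths.

Notation Cgamma gamma N := (path_family gamma (in_trees N)).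

(* Main.v *)
(* In the construction of a lift over paths y, the words of psi(tau) - tau      *)
(* only have letters smaller than tau, so <Y, psi(tau)> is the increment of    *)
(* y^tau plus a term depending only on the previous stage.  By induction on    *)
(* |tau|, two lifts which agree on all psi(tau) are therefore built from the   *)
(* same paths, hence are equal.  Both g Xbar and the path associated with M^*X *)
(* pair with psi(tau) to <X, M tau>; so they coincide, and it remains to read  *)
(* off the increments of g on one-letter words.                                *)
Require Import Defs.
From HB Require Import structures.
From mathcomp Require Import all_boot all_order all_algebra finmap.
From mathcomp Require Import interval_inference monalg reals exp.
From mathcomp Require boolp.

Set Implicit Arguments.
Unset Strict Implicit.
Unset Printing Implicit Defensive.

Import Order.TTheory GRing.Theory Num.Theory.
Local Open Scope ring_scope.

(** The heart is triangularity. In the coproduct of a tree [tau] the only term with empty left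
    factor is [1 (x) tau] ([coprod_tree_rem]), so [psi(tau)] is the letter [tau] plus words with
    strictly smaller letters ([msupp_psi_low]). Later Lyons-Victoir stages leave the values on those
    words unchanged ([lift_upto_extends]), so the pairings with [psi(tau)] recover the driving paths
    size by size ([lift_psi]), and a lift is determined by these pairings ([lift_psi_inj]). Applied
    to [act LV g Xbar] and [MXbar], this identifies the two; one-letter words then give the
    increments of [g]. *)

Section Supports.
Context {R : comNzRingType}.

Lemma msupp_otimes {A B : choiceType} (u : {malg R[A]}) (v : {malg R[B]}) p :
  p \in msupp (otimes u v) -> p.1 \in msupp u /\ p.2 \in msupp v.
Proof.
case/msupp_lin => a ua /msupp_lin[b vb].
by rewrite msupp_basis in_fset1 => /eqP ->.
Qed.

Lemma msupp_sum_basis {K : choiceType} (s : seq K) k :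
  k \in msupp (\sum_(x <- s) basis x : {malg R[K]}) -> k \in s.
Proof.
apply: contraTT => ks; rewrite -mcoeff_eq0 raddf_sum /=.
rewrite big1_seq // => x /andP[_ xs].
by rewrite mcoeff_basis; case: eqVneq xs ks => // -> ->.
Qed.

Lemma basisM {K : monomType} (k l : K) :
  basis (mmul k l) = basis k * basis l :> {malg R[K]}.
Proof.
by rewrite malgME !msupp_basis !big_seq_fset1 !mcoeff_basis !eqxx mulr1 unlock.
Qed.

End Supports.

(** * Forests and words: node counts and branches *)

Section Forests.
Context {d : nat}.

(** Canonical forms sort the branches at each node, so only the multiset of branches matters. *)
Lemma Bplus_prod (i : 'I_d.+1) (s : seq (ptree d)) :
  Bplus i (\big[mmul/mone]_(c <- s) ucm (to_tree c)) = to_tree (PNode i s).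
Proof.
apply: val_inj => /=; congr PNode.
apply/perm_sortP; [exact: ptree_le_total | exact: ptree_le_trans
  | exact: ptree_le_anti |].
have canon_val (r : seq (tree d)) : map canon [seq val t | t <- r] = map val r.
  by rewrite -map_comp; apply: eq_map => t /=; apply/eqP/(valP t).
rewrite {}canon_val.
elim: s => [|c s ihs]; first by rewrite big_nil trees1.
rewrite big_cons; apply: perm_trans (perm_map _ (perm_treesM _ _)) _.
by rewrite treesU /= perm_cons.
Qed.

Lemma ucm_neq1 (t : tree d) : ucm t != mone.
Proof.
by apply/eqP => /(congr1 fnodes)/eqP; rewrite fnodesU fnodes1 eqn0Ngt nodes_gt0.
Qed.

Lemma fnodes_trees1 (f : forest d) t : trees f = [:: t] -> fnodes f = nodes t.
Proof. by rewrite /fnodes => -> /=; rewrite addn0. Qed.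

Lemma wnodes_shuffles (u v w : word d) :
  w \in shuffles u v -> wnodes w = (wnodes u + wnodes v)%N.
Proof.
elim: u v w => [|a u ihu] v w; first by rewrite /= inE => /eqP ->.
elim: v w => [|b v ihv] w; first by rewrite /= inE => /eqP ->; rewrite addn0.
rewrite [shuffles _ _]/= mem_cat => /orP[] /mapP[x xs ->].
  by rewrite /wnodes /= -!/(wnodes _) (ihu _ _ xs) addnA.
by rewrite /wnodes /= -!/(wnodes _) (ihv _ xs) addnCA.
Qed.

Lemma wnodes_rcons (w : word d) t : wnodes (rcons w t) = (wnodes w + nodes t)%N.
Proof. by rewrite /wnodes map_rcons sumn_rcons. Qed.

Lemma nodes_le_wnodes (w : word d) t : t \in w -> (nodes t <= wnodes w)%N.
Proof.
elim: w => [//|u w ih]; rewrite inE /wnodes /= -/(wnodes _) => /predU1P[->|/ih].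
  exact: leq_addr.
by move=> tw; rewrite (leq_trans tw) // leq_addl.
Qed.

End Forests.

(** * Triangularity of the coproduct and homogeneity of the Hairer-Kelly map *)

Section HairerKelly.
Context {R : comNzRingType} {d : nat}.
Notation H := {malg R[forest d]}.
Notation HH := {malg R[(forest d * forest d)%type]}.
Notation T := {malg R[word d]}.

Lemma fst_mul_neq1 (x y : HH) p :
    ({in msupp x, forall p, p.1 != mone} \/ {in msupp y, forall p, p.1 != mone}) ->
  p \in msupp (x * y) -> p.1 != mone.
Proof.
move=> xy /msuppM_le[a [b [ax bY ->]]] /=; apply/eqP => /unitm[a1 b1].
by case: xy => [/(_ _ ax)|/(_ _ bY)]; rewrite ?a1 ?b1 eqxx.
Qed.

(** Induction on branches: modulo terms with non-empty left factor, the coproducts of the branches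
    multiply to [1 (x) f]. Such terms are stable under products, since a product of forests is empty
    only if both factors are, and under [id (x) B_+], which acts on the right factor only. *)
Lemma coprod_ptree_rem (t : ptree d) :
  {in msupp (coprod_ptree t - basis (mone, ucm (to_tree t)) : HH),
    forall p, p.1 != mone}.
Proof.
move: t; apply: ptree_ind' => i s ih; rewrite [coprod_ptree _]/=.
set D := foldr _ _ _; pose f := \big[mmul/mone]_(c <- s) ucm (to_tree c).
have Df : {in msupp (D - basis (mone, f) : HH), forall p, p.1 != mone}.
  rewrite {}/D {}/f; elim: s ih => [|c s ihs] /= ih.
    by rewrite big_nil -basis1 subrr => p; rewrite msupp0.
  case: ih => ihc /ihs {}ihs p.
  rewrite big_cons; set z := foldr _ _ _ in ihs *.
  set h := bigop.body _ _ _ in ihs *.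
  have -> : basis (mone, mmul (ucm (to_tree c)) h) =
      basis (mone, ucm (to_tree c)) * basis (mone, h) :> HH.
    by rewrite -basisM [in RHS]/mmul /= /pair_mmul /= mul1m.
  (* Telescoping [a z - b h = (a - b) z + b (z - h)]: each summand has one factor with non-empty
     left components. *)
  rewrite (_ : _ - _ = (coprod_ptree c - basis (mone, ucm (to_tree c))) * z +
     basis (mone, ucm (to_tree c)) * (z - basis (mone, h))); last first.
    by rewrite mulrBl mulrBr addrA subrK.
  move=> /(fsubsetP (msuppD_le _ _)); rewrite in_fsetU => /orP[].
    by apply: fst_mul_neq1; left.
  by apply: fst_mul_neq1; right.
move=> p; rewrite -(Bplus_prod i s) -/f.
rewrite (_ : basis (mone, _) = tens id (BplusH i) (basis (mone, f))); last first.
  by rewrite /tens linU /BplusH linU otimesU.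
rewrite -addrA -linearB => /(fsubsetP (msuppD_le _ _)); rewrite in_fsetU => /orP[].
  by rewrite msupp_basis in_fset1 => /eqP -> /=; exact: ucm_neq1.
case/msupp_lin => q /Df qD /msupp_otimes[].
by rewrite msupp_basis in_fset1 => /eqP ->.
Qed.

Lemma coprod_tree_rem (t : tree d) :
  {in msupp (coprod (basis (ucm t)) - basis (mone, ucm t) : HH),
    forall p, p.1 != mone}.
Proof.
move=> p; rewrite coprodU /coprod_forest treesU big_seq1 -[in ucm t](to_treeK t).
exact: coprod_ptree_rem.
Qed.

Lemma wnodes_foldr_shuffle (F : tree d -> T) (s : seq (tree d)) :
    (forall t, {in msupp (F t), forall w, wnodes w = nodes t}) ->
  {in msupp (foldr shuffle (basis [::]) (map F s)),
    forall w, wnodes w = sumn (map nodes s)}.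
Proof.
move=> Fn; elim: s => [|t s ihs] w /=.
  by rewrite msupp_basis in_fset1 => /eqP ->.
case/msupp_lin => u /Fn <- /msupp_lin[v /ihs <-] /msupp_sum_basis.
exact: wnodes_shuffles.
Qed.

(** [P1] alters only the coefficient of the empty forest, which [append] kills. *)
Lemma msupp_append (F : H -> T) (z : HH) w :
    w \in msupp (append (tens F P1 z)) ->
  exists p u t, [/\ p \in msupp z, u \in msupp (F (basis p.1)),
    trees p.2 = [:: t] & w = rcons u t].
Proof.
case/msupp_lin => -[u h] /msupp_lin[p pz /msupp_otimes[/= up]].
rewrite /P1 => /(fsubsetP (msuppB_le _ _)); rewrite in_fsetU => /orP[|].
  rewrite msupp_basis in_fset1 => /eqP ->.
  case E: (trees p.2) => [|t [|t' s]]; rewrite ?msupp0 //.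
  by rewrite msupp_basis in_fset1 => /eqP ->; exists p, u, t.
move=> /(fsubsetP (msuppZ_le _ _)); rewrite msupp_basis in_fset1 => /eqP ->.
by rewrite trees1 msupp0.
Qed.

(** The coproduct, shuffles and appending a letter all preserve the total number of nodes. *)
Lemma wnodes_psi_rec n (t : tree d) :
  {in msupp (psi_rec n t : T), forall w, wnodes w = nodes t}.
Proof.
elim: n t => [|n ih] t w; first by rewrite msupp0.
case/msupp_append => p [u [t' [/coprod_nodes + + /fnodes_trees1 E ->]]].
rewrite fnodesU linU wnodes_rcons => <- up.
by rewrite (wnodes_foldr_shuffle ih up) -E.
Qed.

Lemma wnodes_psi (f : forest d) :
  {in msupp (psi (basis f) : T), forall w, wnodes w = fnodes f}.
Proof.
rewrite psiU => w; apply: wnodes_foldr_shuffle => t.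
exact: wnodes_psi_rec.
Qed.

Lemma psi1 : psi (basis mone) = basis [::] :> T.
Proof. by rewrite psiU /psi_forest trees1. Qed.

End HairerKelly.

(** * Lifts and their pairings with the Hairer-Kelly map *)

Section Lifts.
Context {R : realType} {d : nat}.

(* The term 1 (x) tau of the coproduct yields the letter tau of psi(tau). *)
Lemma psi_lowE (t : tree d) :
  psi_low t =
    append (tens psi P1 (coprod (basis (ucm t)) - basis (mone, ucm t)))
    :> {malg R[word d]}.
Proof.
rewrite /psi_low psi_treeE /append /tens !linearB /=; congr (_ - _).
rewrite linU /= psi1 /P1 mcoeff_basis.
by rewrite (negPf (ucm_neq1 t)) scale0r subr0 otimesU linU /= treesU.
Qed.

(** Each word comes from a coproduct term with non-empty left factor and a tree on the right; both
    have at least one node, so neither exceeds [k] nodes. *)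
Lemma msupp_psi_low N k (t : tree d) : nodes t = k.+1 -> (k < N)%N ->
  {in msupp (psi_low t : {malg R[word d]}), forall w, in_TN N k w}.
Proof.
move=> tk kN w; rewrite psi_lowE => /msupp_append[p [u [t' [pz up E ->]]]].
have p1 := coprod_tree_rem pz.
have pn : (fnodes p.1 + nodes t')%N = k.+1.
  rewrite -tk -(fnodesU t) -(fnodes_trees1 E).
  move: pz => /(fsubsetP (msuppB_le _ _)).
  rewrite in_fsetU => /orP[/coprod_nodes //|].
  by rewrite msupp_basis in_fset1 => /eqP pE; rewrite pE eqxx in p1.
have uw := wnodes_psi up.
rewrite /in_TN wnodes_rcons uw pn kN andbT all_rcons -ltnS -pn.
rewrite -[X in (X < _)%N]add0n ltn_add2r lt0n.
rewrite (contra_neq (@fnodes_eq0 d p.1) p1) /=; apply/allP => v /nodes_le_wnodes vu.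
by rewrite -ltnS -pn -uw -[X in (X < _)%N]addn0 -addnS leq_add // nodes_gt0.
Qed.

Variables (gamma : R) (N : nat).

(** [P] and [Q] may differ, which allows comparing functionals from different stages. *)
Lemma eq_pairing {K : choiceType} {P Q : pred K} (X : functional R P)
    (Y : functional R Q) h :
  {in msupp h, forall k, ⟨X, basis k⟩ = ⟨Y, basis k⟩} -> ⟨X, h⟩ = ⟨Y, h⟩.
Proof.
move=> XY; rewrite /pairing -(lin_id h) linE /trunc !linear_sum.
by apply: eq_big_seq => k /XY kXY; rewrite !linearZ /=; congr (_ * _).
Qed.

Lemma pairingD {K : choiceType} {P : pred K} (X : functional R P) h h' :
  ⟨X, h + h'⟩ = ⟨X, h⟩ + ⟨X, h'⟩.
Proof. by rewrite /pairing /trunc !linearD. Qed.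

(** The paths start at 0, so increments determine them. Leibniz equality is what lets the fixed
    choice [LV] return the same extension. *)
Lemma eq_path_family (P : pred (tree d)) (x y : path_family gamma P) :
    (forall tau s t, x tau t - x tau s = y tau t - y tau s) -> x = y.
Proof.
case: x y => [x xP] [y yP] /= xy; apply: boolp.eq_exist.
apply: boolp.funext => tau; apply: boolp.funext => t.
have [[+ _] [+ _]] := (xP tau, yP tau); set z := widen_itv _ => x0 y0.
by have := xy tau z t; rewrite /path_fun /= x0 y0 !subr0.
Qed.

Lemma in_TN_le k m (w : word d) : (k <= m)%N -> in_TN N k w -> in_TN N m w.
Proof.
move=> km /andP[/allP wk wN]; rewrite /in_TN wN andbT.
by apply/allP => t /wk /leq_trans; apply.
Qed.

Variable LV : lyons_victoir (d := d) gamma N.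

Lemma lift_upto_extends (y : Cgamma gamma N) k m (kN : (k <= N)%N) (mN : (m <= N)%N)
    s t w : (k <= m)%N -> in_TN N k w ->
  ⟨lift_upto LV y mN s t, basis w⟩ = ⟨lift_upto LV y kN s t, basis w⟩.
Proof.
elim: m mN => [|m ih] mN km wk.
  move: km kN wk; rewrite leqn0 => /eqP -> kN _.
  by rewrite (bool_irrelevance mN kN).
move: km; rewrite leq_eqVlt => /predU1P[E|km].
  by clear ih; move: kN wk; rewrite E => kN _; rewrite (bool_irrelevance mN kN).
by rewrite /= lv_extends; [exact: ih | exact: in_TN_le wk].
Qed.

Lemma lift_letter (y : Cgamma gamma N) (tau : {tau | in_trees N tau}) s t :
  ⟨Defs.lift LV y s t, basis [:: val tau]⟩ = y tau t - y tau s.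
Proof.
case: tau => tau tauN /=; case E: (nodes tau) (nodes_gt0 tau) => [//|k] _.
have kN : (k < N)%N by rewrite -E.
have tk : of_size k.+1 tau by rewrite /of_size E.
(* The letter enters at stage [k.+1] and keeps its value from there on. *)
rewrite /Defs.lift (lift_upto_extends _ kN) //; last first.
  by rewrite /in_TN /wnodes /= E addn0 leqnn kN.
rewrite /= (lv_over _ _ _ _ _ _ (exist _ tau tk)) /=.
by rewrite /path_fun /= /widen_size /= (bool_irrelevance (of_size_in _ _) tauN).
Qed.

Lemma lift_psi (y : Cgamma gamma N) k (kN : (k < N)%N)
    (tau : {tau : tree d | of_size k.+1 tau}) s t :
  ⟨Defs.lift LV y s t, psi (basis (ucm (val tau)))⟩ =
    (y (widen_size kN tau) t - y (widen_size kN tau) s) +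
    ⟨lift_upto LV y (ltnW kN) s t, psi_low (val tau)⟩.
Proof.
rewrite -(lift_letter y (widen_size kN tau)) /=.
rewrite -[psi _](subrK (basis [:: val tau])) -/(psi_low _) pairingD addrC.
congr (_ + _); apply: eq_pairing => w.
move/(msupp_psi_low (eqP (valP tau)) kN).
by apply: lift_upto_extends; apply: ltnW.
Qed.

Lemma lift_psi_inj (x y : Cgamma gamma N) :
    (forall tau : tree d, in_trees N tau -> forall s t,
      ⟨Defs.lift LV x s t, psi (basis (ucm tau))⟩ =
      ⟨Defs.lift LV y s t, psi (basis (ucm tau))⟩) ->
  Defs.lift LV x = Defs.lift LV y.
Proof.
move=> xy.
suff: forall k (kN : (k <= N)%N), lift_upto LV x kN = lift_upto LV y kN by apply.
elim=> [//|k ih] kN /=.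
rewrite (ih (ltnW kN)); congr (LV _ _ _ _); apply: eq_path_family => tau s t /=.
(* The [psi_low] terms see only stage [k], where both lifts agree, so they cancel. *)
have := xy _ (valP (widen_size kN tau)) s t; rewrite !lift_psi ih.
exact: addIr.
Qed.

(** The prescribed increments of [x] subtract exactly the [psi_low] term that [lift_psi] adds
    back. *)
Lemma associated_lift_psi X Xbar : associated LV X Xbar ->
  forall tau : tree d, in_trees N tau -> forall s t,
    ⟨X s t, basis (ucm tau)⟩ = ⟨Xbar s t, psi (basis (ucm tau))⟩.
Proof.
case=> x -> xX tau tauN s t.
case E: (nodes tau) (nodes_gt0 tau) => [//|k] _.
have kN : (k < N)%N by rewrite -E.
have tk : of_size k.+1 tau by rewrite /of_size E.
have := lift_psi x kN (exist _ tau tk) s t; rewrite xX subrK /=.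
by move=> ->.
Qed.

End Lifts.

Theorem theorem4p4 (R : realType) (d : nat) (gamma : R) (N : nat)
    (gamma01 : 0 < gamma < 1) (N_def : N%:Z = Num.floor (gamma^-1))
    (LV : lyons_victoir (d := d) gamma N)
    (M : {linear fspan R (in_HN (d := d) N) -> fspan R (in_HN (d := d) N)})
    (M_admissible : admissible gamma M)
    (X : {i01 R} -> {i01 R} -> functional R (in_HN (d := d) N))
    (X_branched : branched_rough_path gamma X)
    (Xbar MXbar : anisotropic_rough_path gamma N N)
    (Xbar_X : associated LV X Xbar)
    (MXbar_MX : associated LV (dual_action M X) MXbar)
    (g : Cgamma gamma N)
    (gX_MX : forall tau : tree d, in_trees N tau -> forall s t : {i01 R},
      X s t (M (trunc (basis (ucm tau)))) =
        ⟨act LV g Xbar s t, psi (basis (ucm tau))⟩) :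
  forall (tau : {tau : tree d | in_trees N tau}) (s t : {i01 R}),
    g tau t - g tau s =
      ⟨MXbar s t, basis [:: val tau]⟩ - ⟨Xbar s t, basis [:: val tau]⟩.
Proof.
have [x MXbarE _] := MXbar_MX.
have gXbar : act LV g Xbar = MXbar.
  rewrite MXbarE; apply: lift_psi_inj => tau tauN s t.
  (* Both pairings equal that of [X] with [M tau]. *)
  by rewrite -/(act LV g Xbar) -gX_MX // -MXbarE -(associated_lift_psi MXbar_MX).
(* The letter increments of [MXbar] are those of [Xbar] plus those of [g]. *)
move=> tau s t; rewrite -gXbar lift_letter /= -(arp_letter Xbar tau s t).
rewrite [in X in _ = X - _]opprD addrACA [RHS]addrC.
exact/esym/addKr.
Qed.
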